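(* Let $\mathcal{X}$ be a Banach space of analytic functions on $\mathbb{D}$ such that (i) $\mathcal{F}\subseteq\mathcal{X}$, and (ii) for every disk automorphism $\phi\in\mathrm{Aut}(\mathbb{D})$, the composition operator $C_\phi$ is bounded on $\mathcal{X}$ and $\rho(C_\phi)=1$. Let $\varphi$ be a parabolic disk automorphism. Then the spectrum of $C_\varphi$ acting on $\mathcal{X}$ is the unit circle: $\sigma(C_\varphi)=\partial\mathbb{D}$.
   Context: $\mathbb{D}=\{z\in\mathbb{C}:|z|<1\}$ and $\partial\mathbb{D}$ is the unit circle. $\mathrm{Aut}(\mathbb{D})$ is the group of analytic bijections of $\mathbb{D}$, i.e. the maps $z\mapsto\lambda\frac{a-z}{1-\overline{a}z}$ with $|\lambda|=1$, $a\in\mathbb{D}$. A disk automorphism is parabolic if, as a Möbius map of the Riemann sphere, it has exactly one fixed point, of multiplicity 2, and it lies on $\partial\mathbb{D}$. A Banach space of analytic functions on $\mathbb{D}$ is a complex vector space of analytic functions $\mathbb{D}\to\mathbb{C}$ (with pointwise operations) that is complete under a given norm. For an analytic self-map $\varphi$ of $\mathbb{D}$, $C_\varphi f=f\circ\varphi$. For a bounded operator $T$ on $\mathcal{X}$, $\sigma(T)=\{\lambda\in\mathbb{C}:T-\lambda I\text{ is not invertible}\}$ and $\rho(T)=\sup\{|\lambda|:\lambda\in\sigma(T)\}$. The family $\mathcal{F}$ is the union of: the functions $f_s(z)=\exp\left(\frac{s(z+1)}{z-1}\right)$ for real $s\ge 0$; the functions $f_t(z)=\left(\frac{1+z}{1-z}\right)^{it}=\exp\left(it\log\frac{1+z}{1-z}\right)$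 for $t\in\mathbb{R}$ ($\log$ the principal branch); and the monomials $z^k$ for $k\in\mathbb{N}=\{1,2,\dots\}$. *)

(* Defs.v *)
From HB Require Import structures.
From mathcomp Require Import all_boot all_order all_algebra.
From mathcomp Require Import complex.
From mathcomp Require Import all_classical all_reals all_analysis.
Set Implicit Arguments.
Unset Strict Implicit.
Unset Printing Implicit Defensive.
Import Order.TTheory GRing.Theory Num.Theory.
Import numFieldNormedType.Exports.
Local Open Scope classical_set_scope.
Local Open Scope ring_scope.
Local Open Scope complex_scope.

(* The order of R[i] is partial: `|z| < 1 compares the real number `|z|,
   seen in R[i], with 1. *)
Definition disk (R : realType) : Type := {z : R[i] | `|z| < 1}.

Definition unit_circle (R : realType) : set R[i] := [set z | `|z| = 1].

(* Extension by 0; derivatives at points of the (open) disk do not depend on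
   the values outside. *)
Definition disk_ext (R : realType) (f : disk R -> R[i]) (z : R[i]) : R[i] :=
  oapp f 0 (insub z : option (disk R)).

(* R[i]^o is R[i] as a normed space over the field R[i] itself, so
   derivability in the direction 1 is complex differentiability. *)
Definition analytic (R : realType) (f : disk R -> R[i]) : Prop :=
  forall z : disk R, derivable (disk_ext f : R[i]^o -> R[i]^o) (val z) 1.

Record disk_automorphism (R : realType) := DiskAutomorphism {
  disk_aut_fun :> disk R -> disk R ;
  disk_aut_analytic : analytic (fun z => val (disk_aut_fun z)) ;
  disk_aut_bijective : bijective disk_aut_fun }.

(* Action of z |-> (a z + b) / (c z + d) on the Riemann sphere, represented
   by option R[i] with None as the point at infinity. *)
Definition moebius (R : realType) (a b c d : R[i]) (p : option R[i]) :
    option R[i] :=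
  match p with
  | Some z =>
      if c * z + d == 0 then None else Some ((a * z + b) / (c * z + d))
  | None => if c == 0 then None else Some (a / c)
  end.

(* The multiplicity of a finite fixed point zeta of M is the order of
   vanishing at zeta of
   M z - z = - (c z ^ 2 + (d - a) z - b) / (c z + d);
   the denominator does not vanish at zeta. *)
Definition parabolic (R : realType) (phi : disk_automorphism R) : Prop :=
  exists a b c d : R[i],
    [/\ a * d - b * c != 0,
        forall z : disk R, moebius a b c d (Some (val z)) = Some (val (phi z))
      & exists zeta : R[i],
          [/\ unit_circle zeta,
              forall p : option R[i], moebius a b c d p = p <-> p = Some zeta
            & mup zeta (c *: 'X^2 + (d - a) *: 'X - b%:P) = 2%N]].

(* bsf_eval identifies the Banach space with a space of functions on the
   disk; being linear, it makes the operations pointwise.  Continuity of the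
   point evaluations is not required. *)
Record banach_space_of_analytic_functions (R : realType) :=
  BanachSpaceOfAnalyticFunctions {
    bsf_sort :> completeNormedModType R[i] ;
    bsf_eval : {linear bsf_sort -> (disk R -> R[i]^o)} ;
    bsf_eval_inj : injective bsf_eval ;
    bsf_analytic : forall f : bsf_sort, analytic (bsf_eval f) }.

Arguments bsf_eval {R} _.

Definition composition_operator (R : realType)
    (X : banach_space_of_analytic_functions R) (phi : disk R -> disk R)
    (T : {linear X -> X}) : Prop :=
  forall f : X, bsf_eval X (T f) = bsf_eval X f \o phi.

Definition bounded_operator (R : realType) (X : completeNormedModType R[i])
    (T : {linear X -> X}) : Prop :=
  exists M : R, forall x : X, `|T x| <= M%:C * `|x|.

Definition spectrum (R : realType) (X : completeNormedModType R[i])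
    (T : {linear X -> X}) : set R[i] :=
  [set lambda | ~ exists S : {linear X -> X},
     [/\ bounded_operator S,
         forall x : X, S (T x - lambda *: x) = x
       & forall x : X, T (S x) - lambda *: S x = x]].

Definition spectral_radius (R : realType) (X : completeNormedModType R[i])
    (T : {linear X -> X}) : \bar R :=
  ereal_sup [set (complex.Re `|lambda|)%:E | lambda in spectrum T].

Definition cexp (R : realType) (z : R[i]) : R[i] :=
  (expR (complex.Re z))%:C *
  (cos (complex.Im z) +i* sin (complex.Im z)).

(* Principal argument of z != 0, in ]-pi, pi]. *)
Definition carg (R : realType) (z : R[i]) : R :=
  let theta := acos (complex.Re z / complex.Re `|z|) in
  if 0 <= complex.Im z then theta else - theta.

Definition clog (R : realType) (z : R[i]) : R[i] :=
  ln (complex.Re `|z|) +i* carg z.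

Definition family_F (R : realType) : set (disk R -> R[i]) :=
  [set f | exists2 s : R, 0 <= s &
     f = fun z => cexp (s%:C * (val z + 1) / (val z - 1))] `|`
  [set f | exists t : R,
     f = fun z => cexp ('i * t%:C * clog ((1 + val z) / (1 - val z)))] `|`
  [set f | exists2 k : nat, (0 < k)%N & f = fun z => val z ^+ k].

(* Main.v *)
(* With u = (zeta + z) / (zeta - z), a parabolic automorphism fixing zeta
   becomes a translation u |-> u + i beta of the right half-plane, beta real
   and nonzero.  Rotating f_s = exp (- s u) to zeta gives an eigenvector with
   eigenvalue exp (- i s beta), and every unimodular number has this form for
   some s >= 0.  Conversely phi^-1 is an automorphism too, so both C_phi and
   its inverse have spectral radius 1, which leaves only the unit circle. *)
Require Import Defs.
From HB Require Import structures.
From mathcomp Require Import all_boot all_order all_algebra.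
From mathcomp Require Import complex ring lra.
From mathcomp Require Import all_classical all_reals all_analysis.
Set Implicit Arguments.
Unset Strict Implicit.
Unset Printing Implicit Defensive.
Import Order.TTheory GRing.Theory Num.Theory.
Import numFieldNormedType.Exports.
Local Open Scope classical_set_scope.
Local Open Scope ring_scope.
Local Open Scope complex_scope.

(** * Analyticity of fractional linear maps *)

(** The disk is open, so near each of its points the extension by 0 agrees with the quotient, which
    is differentiable where its denominator is nonzero. *)
Lemma analytic_moebius (R : realType) (f : disk R -> R[i]) (a b c d : R[i]) :
  (forall z : disk R, c * val z + d != 0 /\ f z = (a * val z + b) / (c * val z + d)) ->
  analytic f.
Proof.
move=> hf z; have [dn0 _] := hf z.
pose g : R[i]^o -> R[i]^o := (a \*: (id : R[i]^o -> R[i]^o) + cst b)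
   * (fun w => ((c \*: (id : R[i]^o -> R[i]^o) + cst d) w)^-1).
apply: (@near_eq_derivable _ _ _ g).
  have : nbhs (val z : R[i]^o) [set w : R[i]^o | `|w| < 1].
    have := @nbhsx_ballx _ R[i]^o (val z) (1 - `|val z|).
    rewrite subr_gt0 => /(_ (valP z)).
    apply: filterS => w /=; rewrite -ball_normE /= => h.
    rewrite -(subrK (val z) w) (le_lt_trans (ler_normD _ _))// distrC.
    by rewrite -ltrBrDr.
  apply: filterS => w /= hw.
  rewrite /disk_ext insubT /=.
  by rewrite (hf _).2.
have aff (p q : R[i]) : derivable (p \*: (id : R[i]^o -> R[i]^o) + cst q) (val z) 1.
  apply: (@derivableD _ R[i]^o R[i]^o); last exact: derivable_cst.
  exact/derivableZ/derivable_id.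
apply: (@derivableM _ R[i]^o); first exact: aff.
apply: (@derivableV _ R[i]^o); last exact: aff.
by move: dn0; rewrite !fctE.
Qed.

(** * The exponential and the unit circle *)

Lemma cexpD (R : realType) (z w : R[i]) : cexp (z + w) = cexp z * cexp w.
Proof.
case: z => x y; case: w => x' y'.
rewrite /cexp /= expRD cosD sinD.
apply/eqP; rewrite eq_complex /=; apply/andP; split; apply/eqP; ring.
Qed.

Lemma cexp_neq0 (R : realType) (z : R[i]) : cexp z != 0.
Proof.
have h0 : cexp (0 : R[i]) = 1 by rewrite /cexp /= expR0 cos0 sin0 mulr1.
apply/eqP => h; have := cexpD z (- z).
by rewrite subrr h0 h mul0r => /eqP; rewrite oner_eq0.
Qed.

Lemma unit_circle_cexp (R : realType) (lambda : R[i]) (beta : R) :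
  unit_circle lambda -> beta != 0 ->
  exists2 s : R, 0 <= s & cexp (- (s%:C * (0 +i* beta))) = lambda.
Proof.
move=> hl b0.
have : exists theta, lambda = cos theta +i* sin theta /\ (- pi <= theta <= pi).
  case: lambda hl => x y; rewrite /unit_circle /= normc_def /= => /(@complexI R) h.
  have h2 : x ^+ 2 + y ^+ 2 = 1.
    by rewrite -(sqr_sqrtr (addr_ge0 (sqr_ge0 x) (sqr_ge0 y))) h expr1n.
  have hx : -1 <= x <= 1 by nra.
  have hs : Num.sqrt (1 - x ^+ 2) = `|y|.
    by rewrite -sqrtr_sqr; congr Num.sqrt; lra.
  have ha := acos_ge0 hx; have hb := acos_lepi hx.
  case: (leP 0 y) => y0.
    exists (acos x); rewrite acosK ?in_itv//= sin_acos // hs ger0_norm //; split=> //.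
    by apply/andP; split => //; rewrite (le_trans _ ha) // oppr_le0 pi_ge0.
  exists (- acos x); rewrite cosN sinN acosK ?in_itv//= sin_acos // hs ltr0_norm // opprK; split=> //.
  by lra.
case=> th [-> hth].
have key s : cexp (- (s%:C * (0 +i* beta))) = cos (- (s * beta)) +i* sin (- (s * beta)).
  rewrite /cexp /= !(mul0r, mulr0, subr0, oppr0, expR0, addr0).
  by apply/eqP; rewrite eq_complex /= !(mul0r, mulr0, subr0, addr0, mul1r) !eqxx.
have pi0 := pi_ge0 R.
(* [- (s * beta)] must equal [th] modulo [2 pi]. Since [th] is between [- pi] and [pi], taking
   [th + 2 pi] for negative [beta] and [th - 2 pi] for positive [beta] makes [s] nonnegative. *)
have [bp|bn|/eqP] := ltgtP beta 0; last by rewrite (negPf b0).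
  exists (- (th + pi *+ 2) / beta).
    by rewrite mulr_le0 ?invr_le0 ?(ltW bp)//; lra.
  by rewrite key mulfVK // opprK cosD2pi sinD2pi.
exists ((- th + pi *+ 2) / beta).
  by rewrite divr_ge0 ?(ltW bn)//; lra.
rewrite key mulfVK // -[in RHS](opprK th) !(cosN, sinN).
by rewrite cosD2pi sinD2pi cosN sinN.
Qed.

(** * Eigenvalues and spectra of inverses *)

Lemma eigenvalue_spectrum (R : realType) (X : completeNormedModType R[i])
    (T : {linear X -> X}) (lambda : R[i]) (f : X) :
  f != 0 -> T f = lambda *: f -> spectrum T lambda.
Proof.
move=> f0 Tf [S [_ h _]]; move: (h f).
by rewrite Tf subrr linear0 => /esym/eqP; rewrite (negPf f0).
Qed.

(** Turns an upper bound for the moduli in the spectrum of [B] into a lower bound for those of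
    [A]. *)
Lemma spectrum_inverse (R : realType) (X : completeNormedModType R[i])
    (A B : {linear X -> X}) (lambda : R[i]) :
  bounded_operator B -> cancel A B -> cancel B A ->
  spectrum A lambda -> lambda != 0 /\ spectrum B lambda^-1.
Proof.
move=> [M hM] AB BA sA.
have l0 : lambda != 0.
  apply/eqP => l0; apply: sA; exists B; split; first by exists M.
  - by move=> x; rewrite l0 scale0r subr0.
  - by move=> x; rewrite l0 scale0r subr0.
(* A - lambda = - lambda A (B - lambda^-1). *)
split=> // -[S [[N hN] SB BS]]; apply: sA.
(* The inverse of this product: [B] inverts [A] and [S] inverts [B - lambda^-1]. *)
exists ((- lambda^-1) \*: (S \o B))%R; split.
(* [M] and [N] may be negative; their absolute values keep the estimates monotone. *)
- exists (complex.Re `|lambda^-1| * (`|N| * `|M|)) => x /=.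
  rewrite normrZ normrN.
  have -> : (complex.Re `|lambda^-1| * (`|N| * `|M|))%:C = `|lambda^-1| * (`|N|%:C * `|M|%:C).
    by rewrite !rmorphM; congr (_ * _); exact/RRe_real/ger0_real.
  rewrite -mulrA ler_wpM2l //.
  apply: le_trans (hN _) _.
  apply: (@le_trans _ _ (`|N|%:C * `|B x|)).
    by rewrite ler_wpM2r // lecR ler_norm.
  rewrite -mulrA ler_wpM2l ?ler0c//.
  apply: le_trans (hM _) _.
  by rewrite ler_wpM2r // lecR ler_norm.
- move=> x /=; rewrite linearB /= AB linearZ /=.
  rewrite -[RHS]SB -[in LHS]linearZ /= scalerBr scalerA mulNr mulVf // scaleN1r.
  by rewrite opprK scaleNr addrC.
- move=> x /=; rewrite linearZ /= scalerA mulrN divff // scaleN1r opprK.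
  have := BS (B x) => h.
  have := congr1 A h; rewrite linearB /= linearZ /= !BA => e.
  by rewrite -[RHS]e scaleNr addrC.
Qed.

(** * Parabolic maps as translations of the half-plane *)

(** The coordinate [(zeta + z) / (zeta - z)] sends the double fixed point [zeta] to infinity, so the
    map becomes a translation. The coefficients of [w] are those found in [mup2_quadratic]. *)
Lemma parabolic_cayley (F : fieldType) (a c zeta z : F) :
  a - c * zeta != 0 -> c * z + (a - 2 * c * zeta) != 0 -> z != zeta ->
  let w := (a * z - c * zeta ^+ 2) / (c * z + (a - 2 * c * zeta)) in
  (zeta + w) / (zeta - w) =
  (zeta + z) / (zeta - z) - 2 * zeta * c / (a - c * zeta).
Proof.
move=> h0 d0 zz w.
have e : zeta - w = (a - c * zeta) * (zeta - z) / (c * z + (a - 2 * c * zeta)).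
  by rewrite /w; field.
have zz' : zeta - z != 0 by rewrite subr_eq0 eq_sym.
rewrite e /w; field.
by rewrite zz' d0 h0.
Qed.

(** At a double root the derivative vanishes, which gives [d]; the value vanishes too, which then
    gives [b]. *)
Lemma mup2_quadratic (F : fieldType) (a b c d zeta : F) : c != 0 ->
  mup zeta (c *: 'X^2 + (d - a) *: 'X - b%:P) = 2%N ->
  d = a - 2 * c * zeta /\ b = - (c * zeta ^+ 2).
Proof.
move=> c0; set q := (X in mup _ X) => mq.
have q0 : q != 0.
  apply: contraNneq c0 => /(congr1 (fun p : {poly F} => p`_2)).
  rewrite coefB coefD !coefZ coefXn coefX coefC coef0 /=.
  by rewrite mulr1 mulr0 subr0 addr0 => ->.
have := mup_geq zeta 2 q0; rewrite mq => /esym/dvdpP[k qk].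
have e0 : q.[zeta] = 0.
  by rewrite qk expr2 !(hornerM, hornerXsubC) subrr !mulr0.
have e1 : q^`().[zeta] = 0.
  rewrite qk expr2 !derivM derivXsubC !(hornerXsubC, hornerD, hornerM) subrr.
  by rewrite !(mulr0, mul0r, addr0).
move: e0 e1; rewrite /q !(derivB, derivD, derivZ, derivXn, derivX, derivC) !hornerE /=.
move=> e0 e1.
have ed : d = a - 2 * c * zeta.
  by apply/eqP; rewrite -subr_eq0 -e1; apply/eqP; ring.
split=> //; apply/eqP; rewrite -subr_eq0 -oppr_eq0 -e0 ed; apply/eqP; ring.
Qed.

(** The real part is [(1 - |z|^2) / |zeta - z|^2]. *)
Lemma Re_cayley_gt0 (R : realType) (zeta z : R[i]) :
  `|zeta| = 1 -> `|z| < 1 -> 0 < complex.Re ((zeta + z) / (zeta - z)).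
Proof.
case: zeta => p q; case: z => x y.
rewrite !normc_def /= => /(@complexI R) h; rewrite ltcR => h2.
have {}h : p ^+ 2 + q ^+ 2 = 1.
  by rewrite -(sqr_sqrtr (addr_ge0 (sqr_ge0 p) (sqr_ge0 q))) h expr1n.
have {}h2 : x ^+ 2 + y ^+ 2 < 1.
  by rewrite -[ltLHS](sqr_sqrtr (addr_ge0 (sqr_ge0 x) (sqr_ge0 y))) expr_lt1.
have n0 : 0 < (p - x) ^+ 2 + (q - y) ^+ 2.
  rewrite lt_def addr_ge0 ?sqr_ge0 // andbT paddr_eq0 ?sqr_ge0 //.
  rewrite !sqrf_eq0 !subr_eq0; apply/negP => /andP[/eqP e /eqP e'].
  by move: h2; rewrite -e -e' h ltxx.
set n := (X in 0 < X) in n0.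
rewrite (_ : _ - _ = (1 - (x ^+ 2 + y ^+ 2)) / n).
  by rewrite divr_gt0 // subr_gt0.
by rewrite -h /n; field; exact: lt0r_neq0.
Qed.

(** The inverse of the coordinate is [u |-> zeta * (u - 1) / (u + 1)], and [(r - 1) / (r + 1)] lies
    strictly between -1 and 1. *)
Lemma cayley_pos_preimage (R : realType) (zeta : R[i]) (r : R) :
  `|zeta| = 1 -> 0 < r ->
  exists2 z : R[i], `|z| < 1 & (zeta + z) / (zeta - z) = r%:C.
Proof.
move=> hz r0.
have z0 : zeta != 0 by rewrite -normr_eq0 hz oner_eq0.
exists (zeta * ((r - 1) / (r + 1))%:C).
  rewrite normrM hz mul1r normc_def /= expr0n addr0 sqrtr_sqr ltcR.
  by rewrite normrM normfV (gtr0_norm (_ : 0 < r + 1)) ?ltr_pdivrMr ?ltr_norml; lra.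
set t := (r - 1) / (r + 1).
have -> : r%:C = (1 + t%:C) / (1 - t%:C).
  have -> : r = (1 + t) / (1 - t) by clear hz z0; rewrite /t; field; lra.
  by rewrite rmorphM fmorphV rmorphD rmorphB rmorph1.
by rewrite -[X in X + _]mulr1 -[X in X - _]mulr1 -mulrDr -mulrBr -mulf_div divff ?mul1r.
Qed.

Lemma parabolic_translation (R : realType) (phi : disk_automorphism R) :
  parabolic phi ->
  exists (zeta : R[i]) (beta : R), [/\ `|zeta| = 1, beta != 0 &
    forall z : disk R, (zeta + val (phi z)) / (zeta - val (phi z)) =
      (zeta + val z) / (zeta - val z) + (0 +i* beta)].
Proof.
move=> [a [b [c [d [det0 hM [zeta [hz fix_zeta mz]]]]]]].
(* If c = 0 then infinity would be a second fixed point. *)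
have c0 : c != 0.
  apply/eqP => c0; have := (fix_zeta None).1.
  by rewrite /= c0 eqxx => /(_ erefl).
have [ed eb] := mup2_quadratic c0 mz.
have h0 : a - c * zeta != 0.
  apply: contraNneq det0 => h0; rewrite ed eb.
  have -> : a * (a - 2 * c * zeta) - - (c * zeta ^+ 2) * c = (a - c * zeta) ^+ 2.
    by ring.
  by rewrite h0 expr0n.
have z0 : zeta != 0 by rewrite -normr_eq0 hz oner_eq0.
pose tau := - (2 * zeta * c / (a - c * zeta)).
have tau0 : tau != 0.
  by rewrite oppr_eq0 !mulf_neq0 ?invr_eq0 // pnatr_eq0.
have trans (z : disk R) : (zeta + val (phi z)) / (zeta - val (phi z)) =
      (zeta + val z) / (zeta - val z) + tau.
  have := hM z; rewrite /=; case: eqP => // /eqP d0 [<-].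
  rewrite ed eb in d0 *; apply: parabolic_cayley => //.
  by apply/eqP => /= e; have := valP z; rewrite /= e hz ltxx.
(* Translation by tau maps the half-plane onto itself, so tau is imaginary. *)
have Re_phi (z : disk R) : 0 < complex.Re ((zeta + val z) / (zeta - val z)) + complex.Re tau.
  by have := Re_cayley_gt0 hz (valP (phi z)); rewrite trans raddfD.
(* Otherwise the point with coordinate [- Re tau] would be sent to the imaginary axis. *)
have Re_tau_ge0 : 0 <= complex.Re tau.
  rewrite leNgt; apply/negP => t0.
  have [|w w1 hw] := @cayley_pos_preimage R zeta (- complex.Re tau) hz; first by clear hz; lra.
  by have := Re_phi (exist _ w w1); rewrite /= hw /= addNr ltxx.
(* Otherwise the preimage under [phi] of the point with coordinate [Re tau] would lie on the
   imaginary axis. *)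
have Re_tau_le0 : complex.Re tau <= 0.
  rewrite leNgt; apply/negP => t0.
  have [w w1 hw] := @cayley_pos_preimage R zeta (complex.Re tau) hz t0.
  have [psi _ psiK] := disk_aut_bijective phi.
  have := trans (psi (exist _ w w1)); rewrite psiK /= hw.
  move=> /(congr1 (@complex.Re R)); rewrite raddfD /=.
  have := Re_cayley_gt0 hz (valP (psi (exist _ w w1))).
  by move=> h e; move: h; rewrite -[ltRHS](addrK (complex.Re tau)) -e subrr ltxx.
have Re_tau : complex.Re tau = 0 by apply/le_anti/andP.
have etau : tau = 0 +i* complex.Im tau by rewrite -Re_tau; case: (tau).
exists zeta, (complex.Im tau); split=> //.
  by apply: contraNneq tau0 => e; rewrite etau e.
by rewrite -etau.
Qed.

(** * Rotations, inverses and composition operators *)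

Lemma rotated_cayley (F : fieldType) (s zeta z : F) :
  zeta != 0 -> zeta - z != 0 ->
  s * (zeta^-1 * z + 1) / (zeta^-1 * z - 1) =
  - (s * ((zeta + z) / (zeta - z))).
Proof.
move=> z0 zz; have zz' : z - zeta != 0 by rewrite -opprB oppr_eq0.
by field; rewrite zz z0 mulN1r zz'.
Qed.

(** The family contains [f_s] only with its singularity at 1; composing with a rotation moves it to
    [zeta] without leaving the space. *)
Lemma disk_rotation (R : realType) (zeta : R[i]) : `|zeta| = 1 ->
  exists rho : disk_automorphism R, forall z, val (rho z) = zeta * val z.
Proof.
have rot (xi : R[i]) : `|xi| = 1 -> forall z : disk R, `|xi * val z| < 1.
  by move=> hxi [z z1]; rewrite normrM hxi mul1r.
move=> hz; have hz' : `|zeta^-1| = 1 by rewrite normfV hz invr1.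
have z0 : zeta != 0 by rewrite -normr_eq0 hz oner_eq0.
pose f (z : disk R) : disk R := exist (fun w => is_true (`|w| < 1)) _ (rot _ hz z).
pose g (z : disk R) : disk R := exist (fun w => is_true (`|w| < 1)) _ (rot _ hz' z).
have fan : analytic (fun z => val (f z)).
  apply: (@analytic_moebius _ _ zeta 0 0 1) => z.
  by rewrite !mul0r add0r addr0 divr1 oner_eq0.
have fbij : bijective f.
  by exists g => z; apply: (@val_inj _ (fun w => `|w| < 1) (disk R)) => /=;
    rewrite ?mulKf ?mulVKf.
by exists (DiskAutomorphism fan fbij).
Qed.

Lemma moebius_inverse (R : realType) (phi : disk_automorphism R) (a b c d : R[i]) :
  a * d - b * c != 0 ->
  (forall z : disk R, moebius a b c d (Some (val z)) = Some (val (phi z))) ->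
  exists psi : disk_automorphism R, cancel phi psi /\ cancel psi phi.
Proof.
move=> det0 hM; have [g phiK gK] := disk_aut_bijective phi.
have gan : analytic (fun z => val (g z)).
  (* The coefficients are those of the adjugate matrix. *)
  apply: (@analytic_moebius _ _ d (- b) (- c) a) => w.
  have := hM (g w); rewrite gK /=; case: eqP => // /eqP d0 [<-].
  set z := sval (g w) in d0 *.
  have e : - c * ((a * z + b) / (c * z + d)) + a = (a * d - b * c) / (c * z + d).
    by field.
  split; first by rewrite e mulf_neq0 ?invr_eq0.
  by rewrite e; field; rewrite d0.
by exists (DiskAutomorphism gan (Bijective gK phiK)).
Qed.

(** Composition reverses the order: [B (A f)] evaluates to [f \o phi \o psi]. *)
Lemma composition_operator_cancel (R : realType)
    (X : banach_space_of_analytic_functions R) (phi psi : disk R -> disk R)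
    (A B : {linear X -> X}) :
  composition_operator phi A -> composition_operator psi B ->
  cancel psi phi -> cancel A B.
Proof.
move=> hA hB psiK f; apply: (@bsf_eval_inj _ X).
by rewrite hB hA; apply/funext => z /=; rewrite psiK.
Qed.

Lemma spectral_radius1_le (R : realType) (X : completeNormedModType R[i])
    (T : {linear X -> X}) (lambda : R[i]) :
  spectral_radius T = 1%:E -> spectrum T lambda -> `|lambda| <= 1.
Proof.
move=> hT sl.
have : ((complex.Re `|lambda|)%:E <= spectral_radius T)%E.
  by apply: ereal_sup_ubound; exists lambda.
rewrite hT lee_fin => h.
by rewrite -(RRe_real (ger0_real (normr_ge0 lambda))) lecR.
Qed.

Theorem theorem3p5 (R : realType) (X : banach_space_of_analytic_functions R)
    (hF : @family_F R `<=` range (bsf_eval X))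
    (C : disk_automorphism R -> {linear X -> X})
    (hC : forall phi : disk_automorphism R, composition_operator phi (C phi))
    (hbounded : forall phi : disk_automorphism R, bounded_operator (C phi))
    (hrho : forall phi : disk_automorphism R,
        spectral_radius (C phi) = (1%:E)%E)
    (phi : disk_automorphism R) (hphi : parabolic phi) :
  spectrum (C phi) = @unit_circle R.
Proof.
apply/seteqP; split=> lambda.
- have [a [b [c [d [det0 hM _]]]]] := hphi.
  have [psi [phiK psiK]] := moebius_inverse det0 hM.
  move=> sl.
  have AB := composition_operator_cancel (hC phi) (hC psi) psiK.
  have BA := composition_operator_cancel (hC psi) (hC phi) phiK.
  have [l0 sl'] := spectrum_inverse (hbounded psi) AB BA sl.
  have := spectral_radius1_le (hrho psi) sl'.
  rewrite normfV invf_le1 ?normr_gt0 // => le1.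
  by apply/le_anti; rewrite le1 (spectral_radius1_le (hrho phi) sl).
- move=> hl.
  have [zeta [beta [hz beta0 trans]]] := parabolic_translation hphi.
  have z0 : zeta != 0 by rewrite -normr_eq0 hz oner_eq0.
  have [s s0 es] := unit_circle_cexp hl beta0.
  have [|rho hrot] := @disk_rotation R zeta^-1; first by rewrite normfV hz invr1.
  have [f _ hf] : range (bsf_eval X) (fun z => cexp (s%:C * (val z + 1) / (val z - 1))).
    by apply: hF; left; left; exists s.
  have evalf z : bsf_eval X (C rho f) z =
      cexp (- (s%:C * ((zeta + val z) / (zeta - val z)))).
    rewrite hC hf /= hrot; congr cexp.
    have zz : zeta - val z != 0.
      by rewrite subr_eq0; apply/eqP => /= e; have := valP z; rewrite /= -e hz ltxx.
    exact: rotated_cayley.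
  apply: (@eigenvalue_spectrum _ _ _ _ (C rho f)).
    (* The eigenvector is nonzero because its value at the origin is an exponential. *)
    apply: contraTneq (cexp_neq0 (- (s%:C * ((zeta + 0) / (zeta - 0))))) => f0.
    have h0 : `|0 : R[i]| < 1 by rewrite normr0.
    by have := evalf (exist _ 0 h0); rewrite f0 linear0 /= => <-; rewrite eqxx.
  apply: (@bsf_eval_inj _ X); rewrite hC linearZ; apply/funext => z /=.
  by rewrite evalf trans mulrDr opprD cexpD es mulrC -evalf.
Qed.
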